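(* For every real $x$ with $-e^{-1}\leq x<0$, the principal branch $W_0$ of the Lambert function satisfies $$\sqrt{e\,x+1}-1\;\leq\; W_0(x)\;\leq\;\sqrt[3]{e\,x+1}-1 .$$
   Context: The (real) Lambert function $W$ is defined by $W(x)e^{W(x)}=x$ for real $x\geq -e^{-1}$. For $-e^{-1}\leq x<0$ it has two real branches: the principal branch $W_0(x)$, which is the solution $w$ of $we^{w}=x$ with $w\geq -1$, and $W_{-1}(x)$, the solution with $w\leq -1$; they coincide (with value $-1$) at $x=-e^{-1}$. *)

(* Defs.v *)
From mathcomp Require Import all_boot all_order all_algebra.
From mathcomp Require Import all_classical all_reals all_analysis.
From mathcomp Require Import ring lra.
Set Implicit Arguments.
Unset Strict Implicit.
Unset Printing Implicit Defensive.
Import Order.TTheory GRing.Theory Num.Theory.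
Import numFieldNormedType.Exports.
Local Open Scope classical_set_scope.
Local Open Scope ring_scope.

(* For x < - e^-1 there is no solution and the value is the default 0. *)
Definition lambertW0 (R : realType) (x : R) : R :=
  xget 0 [set w : R | w * expR w = x /\ -1 <= w].

Lemma mul_expR_mono (R : realType) (a b : R) :
  -1 <= a -> a < b -> a * expR a < b * expR b.
Proof.
move=> a1 ab.
have -> : a * expR a = (a * expR (- (b - a))) * expR b.
  by rewrite -mulrA -expRD opprB subrK.
rewrite ltr_pM2r ?expR_gt0//.
have d0 : - (b - a) != 0 by rewrite oppr_eq0 subr_eq0 gt_eqF.
have [a0|a0] := ltP a 0.
  have := expR_gt1Dx d0; nra.
rewrite (le_lt_trans _ ab)// ler_piMr// -expR0 ler_expR; lra.
Qed.

Lemma lambertW0P (R : realType) (x : R) : - (expR 1)^-1 <= x ->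
  lambertW0 x * expR (lambertW0 x) = x /\ -1 <= lambertW0 x.
Proof.
move=> hx; apply: (@xgetPex _ _ [set w : R | w * expR w = x /\ -1 <= w]).
have b0 : 0 <= Num.max 0 x by rewrite le_max lexx.
have ab : -1 <= Num.max 0 x by apply: le_trans b0; lra.
have le_f : x <= Num.max 0 x * expR (Num.max 0 x).
  rewrite (@le_trans _ _ (Num.max 0 x))// ?le_max ?lexx ?orbT//.
  by rewrite ler_peMr// -expR0 ler_expR.
have cf : {within `[-1, Num.max 0 x], continuous (fun w : R => w * expR w)}.
  apply: continuous_subspaceT => w.
  by apply: cvgM; [exact: cvg_id | exact: continuous_expR].
have [|c] := IVT (v := x) ab cf.
  by rewrite mulN1r expRN ge_min hx/= le_max le_f orbT.
by rewrite in_itv/= => /andP[c1 _] fc; exists c.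
Qed.

Lemma lambertW0_unique (R : realType) (x w : R) :
  w * expR w = x -> -1 <= w -> lambertW0 x = w.
Proof.
move=> fw w1; rewrite /lambertW0; case: xgetP => [v _ [fv v1]|/(_ w)[]//].
by case: (ltgtP v w) => // /mul_expR_mono-/(_ ltac:(done)); rewrite fv fw ltxx.
Qed.

(* Main.v *)
Require Import Defs.
From mathcomp Require Import all_boot all_order all_algebra.
From mathcomp Require Import all_classical all_reals all_analysis.
From mathcomp Require Import ring lra.
Set Implicit Arguments.
Unset Strict Implicit.
Unset Printing Implicit Defensive.
Import Order.TTheory GRing.Theory Num.Theory.
Import numFieldNormedType.Exports.
Local Open Scope ring_scope.

(* With u = W_0(x) + 1, which lies in [0, 1), the relation W e^W = x reads
   e x + 1 = 1 - (1 - u) e^u.  Since 1 - u > 0, the two bounds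
   u^3 <= e x + 1 <= u^2 amount to 1 + u <= e^u <= 1 + u + u^2 on [0, 1]. *)

(** The function [g v] = (1 + v + v^2) e^(-v) has derivative v (1 - v) e^(-v), nonnegative on
    [0, 1], so [g u] is at least [g 0] = 1. *)
Lemma expR_le1DxD2 (R : realType) (u : R) :
  0 <= u <= 1 -> expR u <= 1 + u + u ^+ 2.
Proof.
case/andP=> u0 u1; pose g (v : R) := (1 + v + v ^+ 2) * expR (- v).
have dg (v : R) : is_derive v 1 g (v * (1 - v) * expR (- v)).
  apply: is_derive_eq.
  by rewrite /GRing.scale/=; ring.
have : g 0 <= g u.
  apply: (@ger0_derive1_ndecr R g 0 1) => // [v|].
    rewrite in_itv/= => /andP[v0 v1].
    rewrite derive1E (@derive_val _ _ _ _ _ _ _ (dg v)).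
    by rewrite !mulr_ge0 ?expR_ge0 ?subr_ge0 ?ltW.
  apply: continuous_subspaceT => v.
  by apply: differentiable_continuous; apply/derivable1_diffP.
by rewrite /g oppr0 expR0 expr0n/= !addr0 mulr1 expRN ler_pdivlMr ?expR_gt0 ?mul1r.
Qed.

Theorem theorem3p2 (R : realType) (x : R) (hx : - (expR 1)^-1 <= x < 0) :
  Num.sqrt (expR 1 * x + 1) - 1 <= lambertW0 x <= (expR 1 * x + 1) `^ (3%:R^-1) - 1.
Proof.
case/andP: hx => /lambertW0P[]; set w := lambertW0 x => wx w1 x0.
have w0 : w < 0 by move: x0; rewrite -wx pmulr_llt0 ?expR_gt0.
pose u := w + 1.
have u0 : 0 <= u by rewrite /u; lra.
have u1 : 0 <= 1 - u by rewrite /u; lra.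
have exE : expR 1 * x + 1 = 1 - (1 - u) * expR u.
  by rewrite -wx /u expRD; ring.
have lo : expR 1 * x + 1 <= u ^+ 2.
  (* Multiplying 1 + u <= e^u by 1 - u gives 1 - u^2 <= (1 - u) e^u. *)
  by rewrite exE; have := ler_wpM2l u1 (expR_ge1Dx u); nra.
have hi : u ^+ 3 <= expR 1 * x + 1.
  have uP : 0 <= u <= 1 by rewrite u0 -subr_ge0.
  (* Here (1 - u)(1 + u + u^2) telescopes to 1 - u^3. *)
  by rewrite exE; have := ler_wpM2l u1 (expR_le1DxD2 uP); nra.
have u3 : 0 <= u ^+ 3 by rewrite exprn_ge0.
rewrite lerBlDr lerBrDr -/u; apply/andP; split.
  by rewrite -[leRHS]ger0_norm// -sqrtr_sqr ler_sqrt ?sqr_ge0.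
(* Writing u as the cube root of u^3 (valid as u >= 0) reduces the upper bound to monotonicity of
   the cube root on nonnegative reals. *)
rewrite (_ : u = (u ^+ 3) `^ 3%:R^-1); last first.
  by rewrite -powR_mulrn// -powRrM mulfV ?powRr1// pnatr_eq0.
by apply: ge0_ler_powR; rewrite ?invr_ge0 ?nnegrE// (le_trans u3).
Qed.
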